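(* Let $G$ be an $(r,s)$-directed hypergraph with no isolated vertex, and let $p,q\ge1$ be real numbers. (1) If $r/p+s/q<1$, then $G$ has a unique positive eigenpair to $\lambda_{p,q}(G)$. (2) If $r/p+s/q=1$ and $G$ is anadiplosis connected, then $G$ has a unique positive eigenpair to $\lambda_{p,q}(G)$.
   Context: Let $r,s$ be positive integers. An $(r,s)$-directed hypergraph $G$ consists of a finite vertex set $V(G)$ and a finite set $E(G)$ of arcs. Each arc $e$ is an ordered pair $(T(e),H(e))$ of disjoint subsets of $V(G)$ (tail and head) with $|T(e)|=r$ and $|H(e)|=s$. Write $T(G)=\bigcup_eT(e)$ and $H(G)=\bigcup_eH(e)$. ''No isolated vertex'' means every vertex lies in $T(e)\cup H(e)$ for some arc $e$. For real vectors $\mathbf{x}=(x_u)_{u\in T(G)}$ and $\mathbf{y}=(y_v)_{v\in H(G)}$, indexed independently, set $P_G(\mathbf x,\mathbf y)=\sum_{e\in E(G)}\prod_{u\in T(e)}x_u\prod_{v\in H(e)}y_v$. For real $p,q\ge1$ let $\lambda_{p,q}(G)=\max\{P_G(\mathbf x,\mathbf y):\|\mathbf x\|_p=\|\mathbf y\|_q=1\}$. An eigenpair to $\lambda_{p,q}(G)$ is a pair $(\mathbf x,\mathbf y)$ with $\|\mathbf x\|_p=\|\mathbf y\|_q=1$ and $P_G(\mathbf x,\mathbf y)=\lambda_{p,q}(G)$. It is positive if all entries of $\mathbf x$ and $\mathbf y$ are positive. Anadiplosis notions: - An anadiplosis walk from $v_0$ to $v_\ell$ is a sequence $v_0e_1v_1\cdots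 e_\ell v_\ell$ with $v_0\in T(e_1)\cup H(e_1)$, $v_\ell\in T(e_\ell)\cup H(e_\ell)$, and for each $1\le i\le \ell-1$ either $v_i\in T(e_i)\cap T(e_{i+1})$ or $v_i\in H(e_i)\cap H(e_{i+1})$. - An anadiplosis semi-cycle is such a walk with $\ell\ge2$, pairwise distinct arcs, and $v_0=v_\ell\in T(e_1)\cap H(e_\ell)$ or $v_0=v_\ell\in H(e_1)\cap T(e_\ell)$. - $G$ is anadiplosis connected if every two distinct vertices are joined by an anadiplosis walk and every $u\in T(G)\cap H(G)$ has an anadiplosis semi-cycle from $u$ to $u$. *)

(* Defs.v *)
From HB Require Import structures.
From mathcomp Require Import all_boot all_order all_algebra.
From mathcomp Require Import all_classical all_reals all_analysis.

Set Implicit Arguments.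
Unset Strict Implicit.
Unset Printing Implicit Defensive.

Import Order.TTheory GRing.Theory Num.Theory.
Local Open Scope ring_scope.

(* An arc [e] is the pair (T(e), H(e)) = ([e.1], [e.2]). *)
Definition darc (V : finType) : finType := ({set V} * {set V})%type.

Record dihypergraph (r s : nat) (V : finType) := DiHypergraph {
  arcs : {set darc V};
  arcsP : forall e : darc V, e \in arcs ->
    [/\ [disjoint e.1 & e.2], #|e.1| = r & #|e.2| = s]
}.

Section Dihypergraph.
Variables (r s : nat) (V : finType) (G : dihypergraph r s V).

Definition tails : {set V} := \bigcup_(e in arcs G) e.1.
Definition heads : {set V} := \bigcup_(e in arcs G) e.2.

Definition no_isolated_vertex : Prop :=
  forall u : V, exists2 e : darc V, e \in arcs G & u \in e.1 :|: e.2.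

(* The sequence v_0 e_1 v_1 ... e_l v_l is given by [v] on 0..l and [e] on
   1..l; the values of [v] and [e] outside these ranges are irrelevant. *)
Definition anadiplosis_walk (l : nat) (v : nat -> V) (e : nat -> darc V) : Prop :=
  [/\ (0 < l)%N,
      forall i, (1 <= i <= l)%N -> e i \in arcs G,
      v 0%N \in (e 1%N).1 :|: (e 1%N).2,
      v l \in (e l).1 :|: (e l).2 &
      forall i, (1 <= i <= l - 1)%N ->
        v i \in (e i).1 :&: (e i.+1).1 \/ v i \in (e i).2 :&: (e i.+1).2].

Definition anadiplosis_semicycle (l : nat) (v : nat -> V) (e : nat -> darc V) :
    Prop :=
  [/\ anadiplosis_walk l v e,
      (2 <= l)%N,
      forall i j, (1 <= i <= l)%N -> (1 <= j <= l)%N -> e i = e j -> i = j,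
      v 0%N = v l &
      v 0%N \in (e 1%N).1 :&: (e l).2 \/ v 0%N \in (e 1%N).2 :&: (e l).1].

Definition anadiplosis_connected : Prop :=
  (forall u w : V, u != w ->
     exists l v e, [/\ anadiplosis_walk l v e, v 0%N = u & v l = w]) /\
  (forall u : V, u \in tails :&: heads ->
     exists l v e, anadiplosis_semicycle l v e /\ v 0%N = u).

Variable R : realType.

(* Real vectors indexed by T(G) and by H(G). *)
Definition tail_vec : Type := {ffun {u : V | u \in tails} -> R}.
Definition head_vec : Type := {ffun {v : V | v \in heads} -> R}.

(* T(e) and H(e) are contained in T(G) and H(G), so the filtered products over
   the index types run over all of T(e) and H(e). *)
Definition polyform (x : tail_vec) (y : head_vec) : R :=
  \sum_(e in arcs G)
    (\prod_(u : {u : V | u \in tails} | val u \in e.1) x u) *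
    (\prod_(v : {v : V | v \in heads} | val v \in e.2) y v).

Definition pnorm (I : finType) (p : R) (x : {ffun I -> R}) : R :=
  (\sum_(i : I) `|x i| `^ p) `^ p^-1.

(* The maximum is attained whenever [G] has an arc, since the product of the
   two unit spheres is then nonempty and compact. *)
Definition lambda (p q : R) : R :=
  sup [set t : R | exists (x : tail_vec) (y : head_vec),
         [/\ pnorm p x = 1, pnorm q y = 1 & t = polyform x y]]%classic.

Definition eigenpair (p q : R) (x : tail_vec) (y : head_vec) : Prop :=
  [/\ pnorm p x = 1, pnorm q y = 1 & polyform x y = lambda p q].

Definition positive_eigenpair (p q : R) (x : tail_vec) (y : head_vec) : Prop :=
  [/\ eigenpair p q x y, forall u, 0 < x u & forall v, 0 < y v].

End Dihypergraph.

(* Main.v *)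
(* In the variables [z_u = x_u^p] and [z_v = y_v^q] the two unit spheres become
   simplices, and every arc contributes a weighted geometric mean whose total
   weight [r/p + s/q] is at most 1; the form is therefore concave, and a
   maximizer exists by compactness.

   Positivity: replacing the zero entries of one arc, of total weight [W], by
   [eps] gains [c * eps^W] and costs only [O(eps)] in renormalization.  Hence
   [W >= 1], which is impossible if [r/p + s/q < 1] and forces the whole arc to
   vanish if [r/p + s/q = 1]; in that case the support is a union of connected
   components.

   Uniqueness: two positive maximizers give equality in weighted AM-GM on every
   arc at their midpoint.  So their ratio is 1 on each arc if [r/p + s/q < 1],
   and constant on each arc, hence everywhere by connectedness, if
   [r/p + s/q = 1].  Semi-cycles are what connects the variables [x_u] and [y_u]
   of a vertex that is both a tail and a head. *)
Require Import Defs.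
From HB Require Import structures.
From mathcomp Require Import all_boot all_order all_algebra.
From mathcomp Require Import all_classical all_reals all_analysis.
From mathcomp Require Import ring lra.

Set Implicit Arguments.
Unset Strict Implicit.
Unset Printing Implicit Defensive.

Import Order.TTheory GRing.Theory Num.Theory.
Import numFieldNormedType.Exports.
Local Open Scope ring_scope.

(** * Tangent lines of the logarithm, and real powers near zero *)

Section RealPowers.
Variable R : realType.
Implicit Types x a : R.

(** This is [1 + s <= expR s] at [s = ln (x / a)]. *)
Lemma ln_le_tangent x a : 0 < x -> 0 < a -> ln x <= ln a + (x / a - 1).
Proof.
move=> x0 a0; rewrite -lerBlDl -ln_div//.
have := expR_ge1Dx (ln (x / a)); rewrite lnK ?posrE ?divr_gt0//; lra.
Qed.

(** The exponential bound is strict unless [s = 0], so touching the tangent forces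
    [ln (x / a) = 0]. *)
Lemma ln_eq_tangent x a :
  0 < x -> 0 < a -> ln x = ln a + (x / a - 1) -> x = a.
Proof.
move=> x0 a0 e; have xa0 : 0 < x / a by rewrite divr_gt0.
have {}e : ln (x / a) = x / a - 1 by rewrite ln_div// e; ring.
have [l0|/expR_gt1Dx] := eqVneq (ln (x / a)) 0; last first.
  by rewrite lnK ?posrE// e addrC subrK ltxx.
have : x / a = 1 by rewrite -(@lnK _ (x / a)) ?posrE// l0 expR0.
by move=> /divr1_eq.
Qed.

Lemma normr_powR_continuous (w : R) : 0 < w -> continuous (fun a : R => `|a| `^ w).
Proof.
move=> w0 x; rewrite /continuous_at; have [->|x0] := eqVneq x 0.
  rewrite normr0 powR0 ?gt_eqF//; apply/cvgrPdist_lt => e e0.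
  have near0 : \forall a \near (0 : R), `|a| < e `^ w^-1.
    by apply: (@nbhs0_lt R R^o); exact: powR_gt0.
  near=> a; rewrite sub0r normrN ger0_norm ?powR_ge0//.
  have -> : e = (e `^ w^-1) `^ w.
    by rewrite -powRrM mulVf ?gt_eqF// powRr1// ltW.
  rewrite gt0_ltr_powR ?nnegrE ?powR_ge0//.
  near: a; exact: near0.
rewrite {2}/powR normr_eq0 (negPf x0).
apply: (@cvg_trans _ (expR (w * ln `|a|) @[a --> x])%classic); last first.
  have ln_cvg : (ln `|a| @[a --> x] --> ln `|x|)%classic.
    apply: (@cvg_comp _ _ _ (fun a : R => `|a|) (@ln R) _ (nbhs `|x|)).
      exact: (@norm_continuous R R^o x).
    by apply: continuous_ln; rewrite normr_gt0.
  apply: (@cvg_comp _ _ _ (fun a : R => w * ln `|a|) expR _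
    (nbhs (w * ln `|x|))); first exact: cvgMr.
  exact: continuous_expR.
have near_neq0 : \forall a \near x, a != 0.
  by apply: open_nbhs_nbhs; split => //; exact: open_neq.
apply: near_eq_cvg; near=> a.
rewrite /powR normr_eq0 ifF//; apply/negbTE.
near: a; exact: near_neq0.
Unshelve. all: by end_near. Qed.

Lemma exists_powR_gt_linear (b c w : R) : 0 <= b -> 0 < c -> w < 1 ->
  exists2 e : R, 0 < e & b * e < c * e `^ w.
Proof.
move=> b0 c0 w1; have b1 : 0 < b + 1 by lra.
have cb0 : 0 < c / (b + 1) by rewrite divr_gt0.
(* This [e] makes [(b + 1) * e] equal to [c] times the [w]-th power of [e]; the added 1 gives
   strictness and covers [b = 0]. *)
pose e := (c / (b + 1)) `^ (1 - w)^-1.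
have e0 : 0 < e by rewrite powR_gt0.
have ew : e `^ (1 - w) = c / (b + 1).
  have w'0 : 1 - w != 0 by rewrite gt_eqF// subr_gt0.
  by rewrite -powRrM mulVf// powRr1// ltW.
exists e => //.
have -> : b * e = b / (b + 1) * (c * e `^ w).
  have {1}-> : e = e `^ w * (c / (b + 1)).
    rewrite -ew -powRD; last by rewrite (gt_eqF e0) implybT.
    by rewrite addrC subrK powRr1 ?ltW.
  by field; rewrite gt_eqF.
rewrite -[ltRHS]mul1r ltr_pM2r ?mulr_gt0 ?powR_gt0//.
by rewrite ltr_pdivrMr// mul1r; lra.
Qed.

End RealPowers.

(** * Weighted AM-GM with its equality case, and midpoint concavity of monomials *)

Section WeightedMeans.
Variables (R : realType) (I : finType) (w : I -> R) (A : {set I}).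
Hypothesis w_gt0 : forall i, 0 < w i.
Hypothesis w_le1 : \sum_(i in A) w i <= 1.

Lemma prod_powR_expR (t : I -> R) : (forall i, i \in A -> 0 < t i) ->
  \prod_(i in A) t i `^ w i = expR (\sum_(i in A) w i * ln (t i)).
Proof.
move=> t0; rewrite expR_sum; apply: eq_bigr => i iA.
by rewrite /powR gt_eqF// t0.
Qed.

(* The missing weight [1 - \sum w] is put on the number 1. *)
Let mean (t : I -> R) := \sum_(i in A) w i * t i + (1 - \sum_(i in A) w i).

Lemma wmean_gt0 (t : I -> R) : (forall i, i \in A -> 0 < t i) -> 0 < mean t.
Proof.
move=> t0; rewrite /mean; have [->|[i0 i0A]] := set_0Vmem A.
  by rewrite !big_set0 subr0 add0r ltr01.
apply: ltr_wpDr; first by rewrite subr_ge0.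
rewrite (bigD1 i0)//= ltr_wpDr ?mulr_gt0 ?t0//.
by apply: sumr_ge0 => i /andP[iA _]; rewrite ltW// mulr_gt0 ?t0.
Qed.

(** Tangents to [ln] at [mean t] are averaged over the points [t i] and the extra point 1; the
    linear terms cancel because [mean t] is the weighted average of these points. *)
Lemma sum_tangent (t : I -> R) : (forall i, i \in A -> 0 < t i) ->
  \sum_(i in A) w i * (ln (mean t) + (t i / mean t - 1)) +
   (1 - \sum_(i in A) w i) * (ln (mean t) + (1 / mean t - 1)) = ln (mean t).
Proof.
move=> t0; have m0 := wmean_gt0 t0.
have -> : \sum_(i in A) w i * (ln (mean t) + (t i / mean t - 1)) =
  (\sum_(i in A) w i) * (ln (mean t) - 1) + (\sum_(i in A) w i * t i) / mean t.
  by rewrite !mulr_suml -big_split/=; apply: eq_bigr => i _; ring.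
have : \sum_(i in A) w i * t i = mean t - (1 - \sum_(i in A) w i).
  by rewrite /mean addrK.
move=> ->; field; by rewrite gt_eqF.
Qed.

(** After taking logarithms, each [ln (t i)] lies below its tangent at the mean, and so does
    [ln 1 = 0] for the extra point; [sum_tangent] adds up the bounds. *)
Lemma powR_AMGM (t : I -> R) : (forall i, i \in A -> 0 < t i) ->
  \prod_(i in A) t i `^ w i <= mean t.
Proof.
move=> t0; have m0 := wmean_gt0 t0.
rewrite prod_powR_expR// -[leRHS]lnK ?posrE// ler_expR -(sum_tangent t0).
have h1 : 0 <= (1 - \sum_(i in A) w i) * (ln (mean t) + (1 / mean t - 1)).
  rewrite mulr_ge0//; first by rewrite subr_ge0.
  by rewrite -[leLHS]ln1 ln_le_tangent.
apply: ler_wpDr => //.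
by apply: ler_sum => i iA; rewrite ler_pM2l// ln_le_tangent ?t0.
Qed.

(** Since the weights [w i] are positive, equality of the sums makes every tangent bound an
    equality, and [ln_eq_tangent] applies. *)
Lemma powR_AMGM_eq (t : I -> R) : (forall i, i \in A -> 0 < t i) ->
  \prod_(i in A) t i `^ w i = mean t -> forall i, i \in A -> t i = mean t.
Proof.
move=> t0; have m0 := wmean_gt0 t0.
rewrite prod_powR_expR// => H.
have {}H : \sum_(i in A) w i * ln (t i) = ln (mean t) by rewrite -H expRK.
have h1 : 0 <= (1 - \sum_(i in A) w i) * (ln (mean t) + (1 / mean t - 1)).
  rewrite mulr_ge0//; first by rewrite subr_ge0.
  by rewrite -[leLHS]ln1 ln_le_tangent.
move=> i iA; apply: ln_eq_tangent => //; first exact: t0.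
apply/eqP; rewrite eq_le ln_le_tangent ?t0//=.
rewrite -(ler_pM2l (w_gt0 i)).
have := sum_tangent t0; rewrite -[in X in _ = X -> _]H.
rewrite (bigD1 i)//= [in X in _ = X -> _](bigD1 i)//=.
have : \sum_(i0 in A | i0 != i) w i0 * ln (t i0) <=
  \sum_(i0 in A | i0 != i) w i0 * (ln (mean t) + (t i0 / mean t - 1)).
  by apply: ler_sum => j /andP[jA _]; rewrite ler_pM2l// ln_le_tangent ?t0.
lra.
Qed.

Lemma mean_add (t t' : I -> R) :
  mean (fun i => t i + t' i) = mean t + mean t' - (1 - \sum_(i in A) w i).
Proof.
rewrite /mean; under eq_bigr do rewrite mulrDr.
rewrite big_split/=; ring.
Qed.

Let prodw (z : I -> R) := \prod_(i in A) z i `^ w i.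
Let mid (z z' : I -> R) i := (z i + z' i) / 2.

Lemma prodw_ratio (z m : I -> R) :
  (forall i, i \in A -> 0 < z i) -> (forall i, i \in A -> 0 < m i) ->
  prodw z = prodw m * prodw (fun i => z i / m i).
Proof.
move=> z0 m0; rewrite /prodw -big_split/=; apply: eq_bigr => i iA.
have mi := m0 i iA; have zi := z0 i iA.
by rewrite -powRM ?divr_ge0 ?ltW// mulrC divfK ?gt_eqF.
Qed.

Section Midpoint.
Variables z z' : I -> R.
Hypothesis z_gt0 : forall i, i \in A -> 0 < z i.
Hypothesis z'_gt0 : forall i, i \in A -> 0 < z' i.

Let m_gt0 i : i \in A -> 0 < mid z z' i.
Proof. by move=> iA; have := z_gt0 iA; have := z'_gt0 iA; rewrite /mid; lra. Qed.

Let t i := z i / mid z z' i.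
Let t' i := z' i / mid z z' i.

Let t_gt0 i : i \in A -> 0 < t i.
Proof. by move=> iA; rewrite divr_gt0 ?m_gt0 ?z_gt0. Qed.

Let t'_gt0 i : i \in A -> 0 < t' i.
Proof. by move=> iA; rewrite divr_gt0 ?m_gt0 ?z'_gt0. Qed.

Let mean_sum : mean t + mean t' = 2.
Proof.
have -> : mean t + mean t' = mean (fun i => t i + t' i) + (1 - \sum_(i in A) w i).
  by rewrite mean_add; ring.
have -> : mean (fun i => t i + t' i) = \sum_(i in A) w i * 2 + (1 - \sum_(i in A) w i).
  rewrite /mean; congr (_ + _); apply: eq_bigr => i iA; congr (_ * _).
  have := m_gt0 iA; rewrite /t /t' /mid => mi; field.
  by apply/eqP => h; move: mi; rewrite h mul0r ltxx.
rewrite -mulr_suml; ring.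
Qed.

(** Midpoint concavity: once the midpoint is factored out, [t i + t' i = 2], so the two means add up
    to 2 and AM-GM for [t] and for [t'] suffices. *)
Lemma prodw_midpoint : prodw z + prodw z' <= 2 * prodw (mid z z').
Proof.
rewrite (prodw_ratio z_gt0 m_gt0) (prodw_ratio z'_gt0 m_gt0) -mulrDr mulrC.
apply: ler_wpM2r; first by apply: prodr_ge0 => i _; exact: powR_ge0.
have := powR_AMGM t_gt0; have := powR_AMGM t'_gt0; have := mean_sum.
rewrite /prodw /t /t'; lra.
Qed.

(** The two AM-GM bounds add up to exactly 2, so equality leaves no slack in either. *)
Lemma prodw_midpoint_eq : prodw z + prodw z' = 2 * prodw (mid z z') ->
  forall i, i \in A -> t i = mean t.
Proof.
rewrite (prodw_ratio z_gt0 m_gt0) (prodw_ratio z'_gt0 m_gt0) -mulrDr mulrC.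
have p0 : prodw (mid z z') != 0.
  by rewrite gt_eqF//; apply: prodr_gt0 => i iA; rewrite powR_gt0// m_gt0.
move=> /(mulIf p0) H; apply: powR_AMGM_eq t_gt0 _.
have := powR_AMGM t_gt0; have := powR_AMGM t'_gt0; have := mean_sum.
move: H; rewrite /prodw -/(t _) -/(t' _); lra.
Qed.

End Midpoint.
End WeightedMeans.

(** * Maximizers of sums of weighted monomials over a product of simplices *)

Section MonomialSums.
Variables (R : realType) (I J K : finType).
Variables (w : I -> R) (E : {set J}) (S : J -> {set I}) (c : I -> K).
Hypothesis w_gt0 : forall i, 0 < w i.
Hypothesis w_le1 : forall e, e \in E -> \sum_(i in S e) w i <= 1.

Definition wmonomial (z : I -> R) (e : J) : R := \prod_(i in S e) z i `^ w i.

Definition wsum (z : I -> R) : R := \sum_(e in E) wmonomial z e.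

(** The map [c] sorts the variables into classes, with one simplex per class; the application has
    two classes, tails and heads. *)
Definition in_simplices (z : I -> R) : Prop :=
  (forall i, 0 <= z i) /\ (forall k, \sum_(i | c i == k) z i = 1).

Definition wsum_maximizer (z : I -> R) : Prop :=
  in_simplices z /\ forall z', in_simplices z' -> wsum z' <= wsum z.

Lemma wmonomial_ge0 z e : 0 <= wmonomial z e.
Proof. by apply: prodr_ge0 => i _; exact: powR_ge0. Qed.

Lemma le_wmonomial z z' e : (forall i, 0 <= z i) -> (forall i, z i <= z' i) ->
  wmonomial z e <= wmonomial z' e.
Proof.
move=> z0 zz'; apply: ler_prod => i _; rewrite powR_ge0/=.
by rewrite ge0_ler_powR ?nnegrE ?(ltW (w_gt0 i))// (le_trans (z0 i)).
Qed.

Lemma in_simplices_le1 z i : in_simplices z -> z i <= 1.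
Proof.
move=> [z0 z1]; rewrite -(z1 (c i)) (bigD1 i)//= lerDl.
exact: sumr_ge0.
Qed.

Import ArrowAsProduct.

(** Extreme value theorem: the product of simplices is closed in the cube of vectors with entries in
    $[0,1]$, which is compact by Tychonoff. *)
Lemma wsum_maximizer_exists : (forall k, exists i, c i = k) ->
  exists z, wsum_maximizer z.
Proof.
move=> /choice[g gK].
(* Nonemptiness witness: each class puts all its mass on one chosen variable. *)
pose g0 : I -> R := fun i => (i == g (c i))%:R.
(* The absolute values make [f] continuous on the whole space and change nothing on the
   simplices. *)
pose f (z : I -> R) : R := \sum_(e in E) \prod_(i in S e) `|z i| `^ w i.
have fE z : in_simplices z -> f z = wsum z.
  move=> [z0 _]; apply: eq_bigr => e _; apply: eq_bigr => i _.
  by rewrite ger0_norm.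
have sum_cont (T : finType) (P : pred T) (h : T -> (I -> R) -> R) :
    (forall i, continuous (h i)) -> continuous (fun z => \sum_(i | P i) h i z).
  move=> hc; apply: (@continuous_big _ _ _ _ P) => //.
  exact: add_continuous.
have prod_cont (T : finType) (P : pred T) (h : T -> (I -> R) -> R) :
    (forall i, continuous (h i)) -> continuous (fun z => \prod_(i | P i) h i z).
  move=> hc; apply: (@continuous_big _ _ _ _ P) => //.
  exact: mul_continuous.
have proj_cont i : continuous (fun z : I -> R => z i).
  exact: (@proj_continuous _ (fun _ => R) i).
have f_cont : continuous f.
  apply: sum_cont => e; apply: prod_cont => i z.
  apply: (@continuous_comp _ _ _ (fun z : I -> R => z i) (fun a => `|a| `^ w i)).
    exact: proj_cont.
  exact: normr_powR_continuous.
have [|||z zA zmax] := @compact_EVT_max _ R f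
    [set z : I -> R | in_simplices z]%classic.
- exists g0; split=> [i|k]; first by rewrite /g0 ler0n.
  rewrite (bigD1 (g k)) ?gK//= /g0 gK eqxx big1 ?addr0// => i /andP[/eqP <-].
  by move=> /negPf ->.
- apply: (@subclosed_compact _ _
    [set z : I -> R | forall i, `[0, 1]%classic (z i)]%classic).
  + have -> : [set z : I -> R | in_simplices z]%classic =
      (\bigcap_(i in [set: I]) ((fun z : I -> R => z i) @^-1` [set x | 0 <= x])
       `&` \bigcap_(k in [set: K])
         ((fun z : I -> R => \sum_(i | c i == k) z i) @^-1` [set x | x = 1]))%classic.
      apply/seteqP; split=> [z [z0 z1]|z [z0 z1]]; split.
      * by move=> i _; exact: z0.
      * by move=> k _; exact: z1.
      * by move=> i; exact: z0.
      * by move=> k; exact: z1.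
    apply: closedI; apply: closed_bigI => i _; apply: preimage_closed.
    * by move=> z _; exact: proj_cont.
    * exact: closed_ge.
    * by move=> z _; apply: sum_cont.
    * exact: closed_eq.
  + by apply: (@tychonoff I (fun _ => R) (fun _ => `[0, 1]%classic)) => i;
    exact: segment_compact.
  + by move=> z zA i /=; rewrite in_itv/= in_simplices_le1// zA.1.
- exact: continuous_subspaceT.
exists z; have {}zA : in_simplices z by rewrite inE in zA.
split=> // z' z'A; rewrite -!fE//; apply: zmax; by rewrite inE.
Qed.

(** Normalizing each class of [y] gives a feasible [y'] with [y <= b * y'] entrywise. Each monomial
    is homogeneous of degree at most 1, so a factor [b >= 1] comes out as at most [b]. *)
Lemma wsum_le_scale z y b : wsum_maximizer z -> (forall i, 0 <= y i) ->
  1 <= b -> (forall k, 0 < \sum_(i | c i == k) y i <= b) ->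
  wsum y <= b * wsum z.
Proof.
move=> [zA zmax] y0 b1 yb; have b0 : 0 < b by lra.
pose N k := \sum_(i | c i == k) y i.
have N0 k : 0 < N k by case/andP: (yb k).
pose y' i := y i / N (c i).
have y'0 i : 0 <= y' i by rewrite divr_ge0// ltW.
have y'A : in_simplices y'.
  split=> // k; rewrite (eq_bigr (fun i => y i / N k)) => [|i /eqP <-//].
  by rewrite -mulr_suml divff ?gt_eqF// N0.
apply: (@le_trans _ _ (b * wsum y')); last by rewrite ler_pM2l ?zmax.
rewrite /wsum mulr_sumr; apply: ler_sum => e eE.
apply: (@le_trans _ _ (wmonomial (fun i => b * y' i) e)).
  apply: le_wmonomial => // i; rewrite /y' mulrA mulrAC.
  rewrite -[leLHS]mul1r ler_wpM2r// ler_pdivlMr// mul1r.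
  by case/andP: (yb (c i)).
have -> : wmonomial (fun i => b * y' i) e =
    b `^ (\sum_(i in S e) w i) * wmonomial y' e.
  rewrite /wmonomial; have -> : b `^ (\sum_(i in S e) w i) =
      \prod_(i in S e) b `^ w i.
    rewrite {1}/powR gt_eqF// mulr_suml expR_sum; apply: eq_bigr => i _.
    by rewrite /powR gt_eqF.
  by rewrite -big_split/=; apply: eq_bigr => i _; rewrite powRM// ltW.
by rewrite ler_wpM2r ?wmonomial_ge0// ler1_powR ?w_le1.
Qed.

(* Raising the zero entries of [e] from 0 to [eps] gains a multiple of
   [eps `^ W], with [W] their total weight, and the renormalization costs
   [O(eps)]. *)
Lemma maximizer_zero_weight z e : wsum_maximizer z -> e \in E ->
  (exists2 i, i \in S e & z i = 0) -> 1 <= \sum_(i in S e | z i == 0) w i.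
Proof.
move=> zM eE [i0 i0e zi0]; rewrite leNgt; apply/negP => W1.
have [[z0 z1] _] := zM.
pose C := \prod_(i in S e | z i != 0) z i `^ w i.
have C0 : 0 < C.
  apply: prodr_gt0 => i /andP[_ zi]; rewrite powR_gt0// lt_neqAle eq_sym zi.
  exact: z0.
have ws0 y : 0 <= wsum y by apply: sumr_ge0 => ? _; exact: wmonomial_ge0.
(* For this [eps] the gain, [C] times a power of [eps], exceeds the cost [#|I| * eps * wsum z]; the
   rest derives the opposite inequality from maximality. *)
have [eps eps0] :=
  exists_powR_gt_linear (mulr_ge0 (ler0n R #|I|) (ws0 z)) C0 W1.
apply/negP; rewrite -leNgt.
pose y i := z i + (if (i \in S e) && (z i == 0) then eps else 0).
have zy i : z i <= y i by rewrite lerDl; case: ifP => // _; exact: ltW.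
have y0 i : 0 <= y i by exact: le_trans (zy i).
have ylb : wsum z + wmonomial y e <= wsum y.
  rewrite /wsum (bigD1 e)//= [leRHS](bigD1 e)//=.
  (* The zero entry [i0] has positive weight, so the whole new monomial is gain. *)
  have -> : wmonomial z e = 0.
    by rewrite /wmonomial (bigD1 i0)//= zi0 powR0 ?mul0r// gt_eqF.
  rewrite add0r addrC lerD2r; apply: ler_sum => e' _; exact: le_wmonomial.
have ye : wmonomial y e = eps `^ (\sum_(i in S e | z i == 0) w i) * C.
  rewrite /wmonomial (bigID (fun i => z i == 0))/=; congr (_ * _).
    rewrite [RHS]/powR gt_eqF// mulr_suml expR_sum; apply: eq_bigr => i.
    by move=> /andP[ie zi]; rewrite /y ie zi (eqP zi) add0r /powR gt_eqF.
  apply: eq_bigr => i /andP[ie zi].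
  by rewrite /y ie (negPf zi) addr0.
have yub : wsum y <= (1 + #|I|%:R * eps) * wsum z.
  apply: wsum_le_scale => //.
    by rewrite lerDl mulr_ge0 ?ler0n// ltW.
  move=> k; rewrite big_split/= z1; apply/andP; split.
    by rewrite ltr_pwDl// sumr_ge0// => i _; case: ifP => // _; exact: ltW.
  rewrite lerD2l.
  (* Crude count: a class grows by at most [eps] for each variable of [I]. *)
  apply: (@le_trans _ _ (\sum_(i : I) eps)); last first.
    by rewrite sumr_const mulr_natl.
  rewrite [leRHS](bigID (fun i => c i == k))/= ler_wpDr//.
    by apply: sumr_ge0 => ? _; exact: ltW.
  by apply: ler_sum => i _; case: ifP => // _; exact: ltW.
move: ylb yub; rewrite ye; lra.
Qed.

Hypothesis E_cover : forall i, exists2 e, e \in E & i \in S e.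

(* The second alternative says that the hypergraph with edges [S e] is
   connected. *)
Hypothesis subcritical_or_connected :
  (forall e, e \in E -> \sum_(i in S e) w i < 1) \/
  (forall Z : {set I}, (exists i, i \in Z) ->
     (forall e, e \in E -> S e \subset Z \/ [disjoint S e & Z]) ->
     forall i, i \in Z).

(** By [maximizer_zero_weight], an edge with a zero entry has zero entries of total weight at least
    1. This contradicts a total below 1; in the connected case it leaves no room for a positive
    entry on that edge. *)
Lemma wsum_maximizer_gt0 z : wsum_maximizer z -> forall i, 0 < z i.
Proof.
move=> zM i; have [[z0 z1] _] := zM; have [lt1|conn] := subcritical_or_connected.
  rewrite lt_neqAle z0 andbT eq_sym; apply/eqP => zi.
  have [e eE ie] := E_cover i.
  have : 1 <= \sum_(i in S e | z i == 0) w i.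
    by apply: maximizer_zero_weight => //; exists i.
  rewrite leNgt => /negP; apply; apply: le_lt_trans (lt1 _ eE).
  rewrite [leRHS](bigID (fun i => z i == 0))/= lerDl.
  by apply: sumr_ge0 => j _; exact: ltW.
suff : i \in [set j | 0 < z j] by rewrite inE.
(* The support of [z] is nonempty because a class sums to 1; it remains to show that an edge not
   contained in it is disjoint from it. *)
apply: conn.
  apply: contrapT => Z0.
  have /eqP := z1 (c i); rewrite big1 ?[0 == _]eq_sym ?oner_eq0// => j _.
  apply/eqP; rewrite eq_le z0 andbT leNgt; apply/negP => zj.
  by apply: Z0; exists j; rewrite inE.
move=> e eE; have [|/subsetPn[j je]] := boolP (S e \subset [set j | 0 < z j]).
  by left.
rewrite inE lt_neqAle z0 andbT negbK eq_sym => /eqP zj.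
right; have W1 : 1 <= \sum_(i in S e | z i == 0) w i.
  by apply: maximizer_zero_weight => //; exists j.
rewrite disjoint_subset; apply/fintype.subsetP => k ke; rewrite !inE -leNgt.
rewrite le_eqVlt; apply/orP; left; apply/eqP/eqP; apply: contraT => zk.
(* A positive entry [k] would push the total weight of [e] above 1. *)
have wk : w k <= \sum_(i in S e | z i != 0) w i.
  rewrite (bigD1 k) ?ke//= lerDl.
  by apply: sumr_ge0 => ? _; exact: ltW.
have := w_le1 eE; rewrite (bigID (fun i => z i == 0))/=.
have := w_gt0 k; lra.
Qed.

(** The midpoint [m] is feasible, so [2 * wsum m] is at most [wsum z + wsum z'], while concavity
    gives the reverse bound edge by edge. Equality thus holds on every edge, and [z / m] is constant
    there. *)
Lemma wsum_maximizer_unique z z' :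
  wsum_maximizer z -> wsum_maximizer z' -> z =1 z'.
Proof.
move=> zM z'M.
have z_gt0 := wsum_maximizer_gt0 zM; have z'_gt0 := wsum_maximizer_gt0 z'M.
have [[z0 z1] zmax] := zM; have [[z'0 z'1] z'max] := z'M.
pose m i := (z i + z' i) / 2.
have m_gt0 i : 0 < m i by have := z_gt0 i; have := z'_gt0 i; rewrite /m; lra.
have mA : in_simplices m.
  split=> [i|k]; first exact: ltW.
  rewrite -mulr_suml big_split/= z1 z'1; lra.
pose mean e := \sum_(i in S e) w i * (z i / m i) + (1 - \sum_(i in S e) w i).
have ratio e i : e \in E -> i \in S e -> z i / m i = mean e.
  move=> eE ie.
  apply: (prodw_midpoint_eq w_gt0 (w_le1 eE)) ie => // {i}.
  have mid e' : e' \in E -> wmonomial z e' + wmonomial z' e' <= 2 * wmonomial m e'.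
    by move=> e'E; apply: (prodw_midpoint w_gt0 (w_le1 e'E)).
  apply/eqP; rewrite eq_le (mid e eE)/=.
  have : 2 * wsum m <= wsum z + wsum z'.
    by have := zmax m mA; have := z'max m mA; lra.
  rewrite /wsum -big_split/= mulr_sumr (bigD1 e)//= [leRHS](bigD1 e)//=.
  have : \sum_(i in E | i != e) (wmonomial z i + wmonomial z' i) <=
         \sum_(i in E | i != e) 2 * wmonomial m i.
    by apply: ler_sum => e' /andP[/mid].
  rewrite /wmonomial; lra.
suff zm i : z i / m i = 1.
  move=> i; have := divr1_eq (zm i); rewrite /m; lra.
have [lt1|conn] := subcritical_or_connected.
  have [e eE ie] := E_cover i.
  (* With [W] the weight of [e], the common ratio [t] satisfies [t = W * t + (1 - W)], that is
     [(1 - W) * (t - 1) = 0], and [W < 1]. *)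
  have : mean e = \sum_(j in S e) w j * mean e + (1 - \sum_(j in S e) w j).
    rewrite {1}/mean; congr (_ + _); apply: eq_bigr => j je.
    by rewrite (ratio e j eE je).
  rewrite -mulr_suml -(ratio e i eE ie) => h.
  have /eqP : (1 - \sum_(j in S e) w j) * (z i / m i - 1) = 0 by lra.
  rewrite mulf_eq0 => /orP[|]; last by rewrite subr_eq0 => /eqP.
  by rewrite subr_eq0 gt_eqF// lt1.
have Zall k : k \in [set j | z j / m j == z i / m i].
  apply: conn; first by exists i; rewrite inE.
  move=> e eE; have [me|me] := eqVneq (mean e) (z i / m i); [left|right].
    by apply/fintype.subsetP => j je; rewrite inE (ratio e j eE je) me.
  rewrite disjoint_subset; apply/fintype.subsetP => j je.
  by rewrite !inE (ratio e).
(* Now [z] is a constant multiple of [m]; both sum to 1 over a class, so the constant is 1. *)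
have [_ m1] := mA.
rewrite -(z1 (c i)) (eq_bigr (fun j => z i / m i * m j)).
  by rewrite -mulr_sumr m1 mulr1.
move=> j _; have := Zall j; rewrite inE => /eqP <-.
by rewrite divfK ?gt_eqF.
Qed.

End MonomialSums.

(** * Translation between eigenpairs and maximizers on two simplices *)

Section Translation.
Variables (R : realType) (r s : nat) (V : finType) (G : dihypergraph r s V).
Variables (p q : R).
Hypotheses (p_ge1 : 1 <= p) (q_ge1 : 1 <= q).

Let p_gt0 : 0 < p. Proof. exact: lt_le_trans ltr01 p_ge1. Qed.
Let q_gt0 : 0 < q. Proof. exact: lt_le_trans ltr01 q_ge1. Qed.

(* A vertex that is both a tail and a head carries two independent variables:
   [inl u] indexes [x_u] and [inr v] indexes [y_v]. *)
Let var : finType := ({u : V | u \in tails G} + {v : V | v \in heads G})%type.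

Definition arc_vars (e : darc V) : {set var} :=
  [set i : var |
    match i with inl u => val u \in e.1 | inr v => val v \in e.2 end].

Definition var_weight (i : var) : R :=
  match i with inl _ => p^-1 | inr _ => q^-1 end.

Definition is_tail_var (i : var) : bool :=
  match i with inl _ => true | inr _ => false end.

(** The absolute values extend the change of variables to vectors with entries of any sign;
    [tail_roots] and [head_roots] invert it on nonnegative data. *)
Definition norm_powers (x : tail_vec G R) (y : head_vec G R) (i : var) : R :=
  match i with inl u => `|x u| `^ p | inr v => `|y v| `^ q end.

Definition tail_roots (z : var -> R) : tail_vec G R :=
  [ffun u => z (inl u) `^ p^-1].
Definition head_roots (z : var -> R) : head_vec G R :=
  [ffun v => z (inr v) `^ q^-1].

Implicit Types (x : tail_vec G R) (y : head_vec G R) (z : var -> R) (e f : darc V).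

Local Notation F := (wsum var_weight (arcs G) arc_vars).
Local Notation simplices := (in_simplices is_tail_var).
Local Notation maximizer :=
  (wsum_maximizer var_weight (arcs G) arc_vars is_tail_var).

Lemma var_weight_gt0 i : 0 < var_weight i.
Proof. by case: i => ? /=; rewrite invr_gt0. Qed.

Lemma pnorm_eq1 (I : finType) (a : R) (x : {ffun I -> R}) :
  0 < a -> pnorm a x = 1 <-> \sum_i `|x i| `^ a = 1.
Proof.
move=> a0; rewrite /pnorm; split=> [|->]; last by rewrite powR1.
move=> /eqP; rewrite powR_eq1 invr_eq0 (gt_eqF a0) orbF => /orP[/eqP//|].
by rewrite ltNge sumr_ge0// => i _; exact: powR_ge0.
Qed.

Lemma in_simplices_norm_powers x y :
  simplices (norm_powers x y) <-> pnorm p x = 1 /\ pnorm q y = 1.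
Proof.
rewrite !pnorm_eq1//; split.
  move=> [_ H]; split.
    by have := H true; rewrite big_sumType/= [X in _ + X]big_pred0// addr0.
  by have := H false; rewrite big_sumType/= [X in X + _]big_pred0// add0r.
move=> [x1 y1]; split=> [[u|v]|[]] /=; rewrite ?powR_ge0//.
  by rewrite big_sumType/= [X in _ + X]big_pred0// addr0 -[RHS]x1.
by rewrite big_sumType/= [X in X + _]big_pred0// add0r -[RHS]y1.
Qed.

Lemma norm_powers_roots z : (forall i, 0 <= z i) ->
  norm_powers (tail_roots z) (head_roots z) =1 z.
Proof.
move=> z0 [u|v] /=; rewrite ffunE ger0_norm ?powR_ge0// -powRrM mulVf ?gt_eqF//;
  by rewrite powRr1.
Qed.

Lemma wsum_norm_powers x y : F (norm_powers x y) =
  \sum_(e in arcs G)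
    (\prod_(u : {u : V | u \in tails G} | val u \in e.1) `|x u|) *
    (\prod_(v : {v : V | v \in heads G} | val v \in e.2) `|y v|).
Proof.
apply: eq_bigr => e _; rewrite /wmonomial big_sumType/=; congr (_ * _).
  apply: eq_big => [u|u _]; first by rewrite inE.
  by rewrite -powRrM mulfV ?gt_eqF// powRr1.
apply: eq_big => [v|v _]; first by rewrite inE.
by rewrite -powRrM mulfV ?gt_eqF// powRr1.
Qed.

(** By the triangle inequality, vectors with negative entries cannot beat the maximum over
    nonnegative ones. *)
Lemma polyform_le_wsum x y : polyform x y <= F (norm_powers x y).
Proof.
rewrite wsum_norm_powers; apply: ler_sum => e _.
by rewrite -!normr_prod -normrM ler_norm.
Qed.

Lemma polyform_ge0E x y : (forall u, 0 <= x u) -> (forall v, 0 <= y v) ->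
  polyform x y = F (norm_powers x y).
Proof.
move=> x0 y0; rewrite wsum_norm_powers; apply: eq_bigr => e _.
by congr (_ * _); apply: eq_bigr => ? _; rewrite ger0_norm.
Qed.

Lemma eq_wsum z z' : z =1 z' -> F z = F z'.
Proof.
by move=> zz'; apply: eq_bigr => e _; apply: eq_bigr => i _; rewrite zz'.
Qed.

Lemma polyform_roots z : (forall i, 0 <= z i) ->
  polyform (tail_roots z) (head_roots z) = F z.
Proof.
move=> z0; rewrite polyform_ge0E => [|u|v]; rewrite ?ffunE ?powR_ge0//.
exact/eq_wsum/norm_powers_roots.
Qed.

Lemma pnorm_roots z : simplices z ->
  pnorm p (tail_roots z) = 1 /\ pnorm q (head_roots z) = 1.
Proof.
move=> [z0 z1]; apply/in_simplices_norm_powers; split=> [i|k].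
  by rewrite norm_powers_roots.
by rewrite -(z1 k); apply: eq_bigr => i _; rewrite norm_powers_roots.
Qed.

(** The value [F z] bounds the form on the unit spheres and is attained at the roots of [z], so the
    supremum is a maximum. *)
Lemma lambda_maximizer z : maximizer z -> lambda G p q = F z.
Proof.
move=> [zA zmax].
have [x1 y1] := pnorm_roots zA.
have ub : ubound [set t : R | exists (x : tail_vec G R) (y : head_vec G R),
    [/\ pnorm p x = 1, pnorm q y = 1 & t = polyform x y]]%classic (F z).
  move=> _ [x [y [x1' y1' ->]]]; apply: le_trans (polyform_le_wsum x y) _.
  exact/zmax/in_simplices_norm_powers.
have Fz : [set t : R | exists (x : tail_vec G R) (y : head_vec G R),
    [/\ pnorm p x = 1, pnorm q y = 1 & t = polyform x y]]%classic (F z).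
  exists (tail_roots z), (head_roots z); split=> //.
  by rewrite polyform_roots//; case: zA.
apply/eqP; rewrite eq_le; apply/andP; split.
  by apply: ge_sup => //; exists (F z).
by apply: ub_le_sup => //; exists (F z).
Qed.

Lemma positive_eigenpair_roots z : maximizer z -> (forall i, 0 < z i) ->
  positive_eigenpair p q (tail_roots z) (head_roots z).
Proof.
move=> zM z0; have [zA _] := zM; have [x1 y1] := pnorm_roots zA.
split=> [|u|v]; rewrite ?ffunE ?powR_gt0//.
by split=> //; rewrite (lambda_maximizer zM) polyform_roots//; case: zA.
Qed.

(** Transfers uniqueness: the given maximizer [z] identifies [lambda] with the maximum of [F], which
    the eigenpair therefore attains. *)
Lemma maximizer_positive_eigenpair z x y : maximizer z ->
  positive_eigenpair p q x y -> maximizer (norm_powers x y).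
Proof.
move=> zM [[x1 y1 xyl] x0 y0]; split; first exact/in_simplices_norm_powers.
move=> z' /(proj2 zM)/le_trans; apply.
by rewrite -(lambda_maximizer zM) -xyl polyform_ge0E// => ?; exact: ltW.
Qed.

Lemma mem_tails e u : e \in arcs G -> u \in e.1 -> u \in tails G.
Proof. by move=> eG ue; apply/finset.bigcupP; exists e. Qed.

Lemma mem_heads e u : e \in arcs G -> u \in e.2 -> u \in heads G.
Proof. by move=> eG ue; apply/finset.bigcupP; exists e. Qed.

(** The [r] tail variables weigh [p^-1] each and the [s] head variables [q^-1] each; [val] is
    injective, so counting in the index types agrees with counting in [V]. *)
Lemma sum_var_weight e : e \in arcs G ->
  \sum_(i in arc_vars e) var_weight i = r%:R / p + s%:R / q.
Proof.
move=> eG; have [_ e1 e2] := arcsP eG.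
rewrite big_sumType/=; congr (_ + _).
  rewrite (eq_bigl (fun u => val u \in e.1)) => [|u]; last by rewrite inE.
  rewrite sumr_const -[LHS]mulr_natl; congr (_%:R * _).
  apply: etrans e1; rewrite -[LHS](card_imset _ val_inj); apply: eq_card => u.
  apply/imsetP/idP => [[u' u'e ->//]|ue].
  by exists (exist _ u (mem_tails eG ue)).
rewrite (eq_bigl (fun v => val v \in e.2)) => [|v]; last by rewrite inE.
rewrite sumr_const -[LHS]mulr_natl; congr (_%:R * _).
apply: etrans e2; rewrite -[LHS](card_imset _ val_inj); apply: eq_card => v.
apply/imsetP/idP => [[v' v'e ->//]|ve].
by exists (exist _ v (mem_heads eG ve)).
Qed.

Lemma arc_vars_cover (i : var) : exists2 e, e \in arcs G & i \in arc_vars e.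
Proof.
by case: i => [[u uG]|[u uG]]; have /finset.bigcupP[e eG ue] := uG;
  exists e; rewrite // inE.
Qed.

(** Some vertex exists and lies on an arc, whose tail and head are nonempty; hence neither simplex
    is empty. *)
Lemma is_tail_var_surj : (0 < r)%N -> (0 < s)%N -> (0 < #|V|)%N ->
  no_isolated_vertex G -> forall k, exists i, is_tail_var i = k.
Proof.
move=> r0 s0 /card_gt0P[w _] /(_ w)[e eG _]; have [_ e1 e2] := arcsP eG.
case.
  have /card_gt0P[u ue] : (0 < #|e.1|)%N by rewrite e1.
  by exists (inl (exist _ u (mem_tails eG ue))).
have /card_gt0P[u ue] : (0 < #|e.2|)%N by rewrite e2.
by exists (inr (exist _ u (mem_heads eG ue))).
Qed.

(** * From anadiplosis connectedness to connectedness of the variables *)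

Section Connectedness.
Variable Z : {set var}.
Hypothesis Z_closed : forall e, e \in arcs G ->
  arc_vars e \subset Z \/ [disjoint arc_vars e & Z].

Let inZ e := arc_vars e \subset Z.

(** The variables of an arc lie all inside or all outside [Z], so any one of them decides [inZ]. *)
Lemma inZ_mem e i : e \in arcs G -> i \in arc_vars e -> inZ e = (i \in Z).
Proof.
move=> eG ie; have [eZ|eZ] := Z_closed eG.
  by rewrite [inZ e]eZ (fintype.subsetP eZ).
have iZ := disjointFr eZ ie; rewrite iZ.
by apply/negP => /fintype.subsetP/(_ _ ie); rewrite iZ.
Qed.

Lemma inZ_tail e f u : e \in arcs G -> f \in arcs G ->
  u \in e.1 -> u \in f.1 -> inZ e = inZ f.
Proof.
move=> eG fG ue uf; pose i : var := inl (exist _ u (mem_tails eG ue)).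
by rewrite (@inZ_mem e i)// ?(@inZ_mem f i)// inE.
Qed.

Lemma inZ_head e f u : e \in arcs G -> f \in arcs G ->
  u \in e.2 -> u \in f.2 -> inZ e = inZ f.
Proof.
move=> eG fG ue uf; pose i : var := inr (exist _ u (mem_heads eG ue)).
by rewrite (@inZ_mem e i)// ?(@inZ_mem f i)// inE.
Qed.

(** Consecutive arcs of a walk share a vertex in the same role, hence a variable, so [inZ]
    propagates by induction. *)
Lemma inZ_walk l v (e : nat -> darc V) : anadiplosis_walk G l v e -> inZ (e 1%N) = inZ (e l).
Proof.
move=> [l0 eG _ _ vstep].
have step i : (i < l)%N -> inZ (e 1%N) = inZ (e i.+1).
  elim: i => // i IH il; rewrite IH ?(ltnW il)//.
  have eiG : e i.+1 \in arcs G by apply: eG; rewrite /= (ltnW il).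
  have eSiG : e i.+2 \in arcs G by exact: eG.
  have /vstep : (1 <= i.+1 <= l - 1)%N by rewrite /= leq_subRL// add1n.
  rewrite !inE => -[/andP[h1 h2]|/andP[h1 h2]].
    exact: inZ_tail h1 h2.
  exact: inZ_head h1 h2.
by case: l l0 step {eG vstep} => // l _; apply.
Qed.

Hypothesis G_connected : anadiplosis_connected G.

(** The first and last arcs of a semi-cycle at [u] contain [u] in opposite roles and agree on [inZ];
    one shares [u] with [e] as a tail, the other shares it with [f] as a head. *)
Lemma inZ_tail_head e f u : e \in arcs G -> f \in arcs G ->
  u \in e.1 -> u \in f.2 -> inZ e = inZ f.
Proof.
move=> eG fG ue uf.
have uTH : u \in tails G :&: heads G.
  by rewrite inE (mem_tails eG ue) (mem_heads fG uf).
have [l [v [a [[aw l2 _ v0l uv] v0]]]] := G_connected.2 u uTH.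
have [l0 aG _ _ _] := aw; have a1l := inZ_walk aw.
have a1G : a 1%N \in arcs G by apply: aG; rewrite /= l0.
have alG : a l \in arcs G by apply: aG; rewrite l0 /=.
move: uv; rewrite v0 !inE => -[/andP[h1 h2]|/andP[h1 h2]].
  by rewrite (inZ_tail eG a1G ue h1) a1l (inZ_head alG fG h2 uf).
by rewrite (inZ_tail eG alG ue h2) -a1l (inZ_head a1G fG h1 uf).
Qed.

Lemma inZ_vertex e f u : e \in arcs G -> f \in arcs G ->
  u \in e.1 :|: e.2 -> u \in f.1 :|: f.2 -> inZ e = inZ f.
Proof.
move=> eG fG; rewrite !inE => /orP[ue|ue] /orP[uf|uf].
- exact: inZ_tail ue uf.
- exact: inZ_tail_head ue uf.
- by rewrite (inZ_tail_head fG eG uf ue).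
- exact: inZ_head ue uf.
Qed.

Lemma inZ_arcs e f u w : e \in arcs G -> f \in arcs G ->
  u \in e.1 :|: e.2 -> w \in f.1 :|: f.2 -> inZ e = inZ f.
Proof.
move=> eG fG ue wf; have [uw|uw] := eqVneq u w.
  by rewrite uw in ue; exact: inZ_vertex ue wf.
have [l [v [a [aw v0 vl]]]] := G_connected.1 u w uw.
have [l0 aG ua wa _] := aw; rewrite v0 in ua; rewrite vl in wa.
rewrite (inZ_vertex eG _ ue ua) ?(inZ_walk aw) ?(inZ_vertex _ fG wa wf)//.
  by apply: aG; rewrite l0 /=.
by apply: aG; rewrite /= l0.
Qed.

Lemma arc_vars_connected : (exists i, i \in Z) -> forall i, i \in Z.
Proof.
have vertex e (i : var) : i \in arc_vars e -> exists u, u \in e.1 :|: e.2.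
  by case: i => u; rewrite inE => ue; exists (val u); rewrite inE ue ?orbT.
move=> [j jZ] i; have [e eG ie] := arc_vars_cover i.
have [f fG jf] := arc_vars_cover j.
have [u ue] := vertex _ _ ie; have [w wf] := vertex _ _ jf.
by rewrite -(inZ_mem eG ie) (inZ_arcs eG fG ue wf) (inZ_mem fG jf).
Qed.

End Connectedness.

(** * Existence and uniqueness of the positive eigenpair *)

Lemma unique_positive_eigenpair :
  (0 < r)%N -> (0 < s)%N -> (0 < #|V|)%N -> no_isolated_vertex G ->
  r%:R / p + s%:R / q < 1 \/
    r%:R / p + s%:R / q = 1 /\ anadiplosis_connected G ->
  exists! xy : tail_vec G R * head_vec G R, positive_eigenpair p q xy.1 xy.2.
Proof.
move=> r0 s0 V0 Giso cases.
have w_le1 e : e \in arcs G -> \sum_(i in arc_vars e) var_weight i <= 1.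
  by move=> eG; rewrite sum_var_weight//; case: cases => [/ltW//|[->]].
have sub_or_conn :
    (forall e, e \in arcs G -> \sum_(i in arc_vars e) var_weight i < 1) \/
    (forall Z : {set var}, (exists i, i \in Z) ->
      (forall e, e \in arcs G -> arc_vars e \subset Z \/ [disjoint arc_vars e & Z]) ->
      forall i, i \in Z).
  case: cases => [lt1|[_ conn]]; [left|right].
    by move=> e eG; rewrite sum_var_weight.
  by move=> Z Zne Zcl; exact: arc_vars_connected.
have [z zM] := wsum_maximizer_exists (arcs G) arc_vars var_weight_gt0
  (is_tail_var_surj r0 s0 V0 Giso).
have z0 := wsum_maximizer_gt0 var_weight_gt0 w_le1 arc_vars_cover sub_or_conn zM.
exists (tail_roots z, head_roots z); split; first exact: positive_eigenpair_roots.
move=> [x y] /= xyP; have [_ x0 y0] := xyP.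
have zxy := wsum_maximizer_unique var_weight_gt0 w_le1 arc_vars_cover sub_or_conn
  zM (maximizer_positive_eigenpair zM xyP).
(* Since [x] and [y] are positive, taking roots of [norm_powers x y] gives them back. *)
congr (_, _); apply/ffunP => u; rewrite ffunE zxy/=.
  by rewrite gtr0_norm// -powRrM mulfV ?gt_eqF// powRr1// ltW.
by rewrite gtr0_norm// -powRrM mulfV ?gt_eqF// powRr1// ltW.
Qed.

End Translation.

Theorem theorem4p5 (R : realType) (r s : nat) (V : finType)
    (G : dihypergraph r s V) (p q : R)
    (r_gt0 : (0 < r)%N) (s_gt0 : (0 < s)%N) (V_gt0 : (0 < #|V|)%N)
    (G_no_isolated : no_isolated_vertex G) (p_ge1 : 1 <= p) (q_ge1 : 1 <= q) :
  (r%:R / p + s%:R / q < 1 ->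
     exists! xy : tail_vec G R * head_vec G R,
       positive_eigenpair p q xy.1 xy.2) /\
  (r%:R / p + s%:R / q = 1 -> anadiplosis_connected G ->
     exists! xy : tail_vec G R * head_vec G R,
       positive_eigenpair p q xy.1 xy.2).
Proof.
split=> [lt1|eq1 conn]; apply: unique_positive_eigenpair => //; first by left.
by right.
Qed.
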